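(* Let $\mathcal{M}$ be an odd-OLF model and let $\mathcal{M}'=\mathcal{M}^o(\Gamma(\mathcal{M}))$ be the oblivious influence model of the influence game $\Gamma(\mathcal{M})$ associated with $\mathcal{M}$. Then the collective decision functions of $\mathcal{M}$ and $\mathcal{M}'$ coincide, i.e. $C_{\mathcal{M}}(x)=C_{\mathcal{M}'}(x)$ for every initial decision vector $x\in\{0,1\}^n$.
   Context: Graphs are finite, directed, without loops or multiple edges; $P_G(i)=\{j\mid (j,i)\in E\}$, $S_G(i)=\{j\mid(i,j)\in E\}$, $\delta^-(i)=|P_G(i)|$. For $x\in\{0,1\}^n$, $X(x)=\{i\mid x_i=1\}$. A gOLF is a triple $\mathcal{M}=(G,r,q)$ where $G=(V,E)$ is a two layered bipartite digraph ($V=V_1\cup V_2$ disjoint, $E\subseteq V_1\times V_2$), $n=|V|$, $r$ is a rational with $1/2\le r\le 1$, $q$ is a natural number with $0<q\le n$. For $x\in\{0,1\}^n$ and $i\in V$, put $p=|\{j\in P_G(i)\mid x_j=1\}|$, $\bar p=|\{j\in P_G(i)\mid x_j=0\}|$, $t=\lceil r|P_G(i)|\rceil$; then $c_i=1$ if $p\ge t$ and $\bar p<t$; $c_i=0$ if $\bar p\ge t$ and $p<t$; $c_i=x_i$ otherwise. $C_{\mathcal{M}}(x)=1$ if $|\{i\in V\mid c_i=1\}|\ge q$, else $0$. Let $\mathtt{L}=\{i\mid P_G(i)=\emptyset,S_G(i)\ne\emptyset\}$, $\mathtt{F}=\{i\mid S_G(i)=\emptyset,P_G(i)\ne\emptyset\}$,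 $\mathtt{I}=\{i\mid S_G(i)=P_G(i)=\emptyset\}$. An odd-OLF is a gOLF with $r=1/2$ and $\delta^-(i)$ odd for all $i\in\mathtt{F}$. The influence game associated with a gOLF is $\Gamma(\mathcal{M})=(G,f,q,N)$ with $N=\mathtt{L}\cup\mathtt{I}$, $f(i)=\lceil r\,\delta^-(i)\rceil$ for $i\in\mathtt{F}$ and $f(i)=1$ for $i\in\mathtt{L}\cup\mathtt{I}$. For an influence game $\Gamma=(G,f,q,N)$ ($G=(V,E)$ a digraph, $f$ a labeling of vertices by positive rationals, $q$ an integer with $0\le q\le n$, $N\subseteq V$) and $X\subseteq V$: $F^0(X)=X$, $F^t(X)=F^{t-1}(X)\cup\{i\in V\mid |P_G(i)\cap F^{t-1}(X)|\ge f(i)\}$ for $1\le t\le n$, $F(X)=F^n(X)$. The oblivious influence model $\mathcal{M}^o(\Gamma)$ has collective decision function $C(x)=1$ if $|F(X(x)\cap N)|\ge q$, else $0$. *)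

(* Defs.v *)
From mathcomp Require Import all_boot all_order all_algebra.

Set Implicit Arguments.
Unset Strict Implicit.
Unset Printing Implicit Defensive.

Import Order.TTheory GRing.Theory Num.Theory.
Local Open Scope ring_scope.

(* The vertices are an arbitrary finType V, so that
   n = #|V|, and a vector x in {0,1}^n is a finite function {ffun V -> bool}. *)

Record digraph (V : finType) := Digraph {
  edge : rel V;
  edge_irrefl : irreflexive edge
}.

Section Digraph.
Variables (V : finType) (G : digraph V).

Definition preds (i : V) : {set V} := [set j | edge G j i].
Definition succs (i : V) : {set V} := [set j | edge G i j].
Definition indegree (i : V) : nat := #|preds i|.

Definition two_layered : Prop :=
  exists V1 V2 : {set V},
    [/\ V1 :|: V2 = [set: V], [disjoint V1 & V2]
      & forall i j, edge G i j -> i \in V1 /\ j \in V2].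

Definition leaders : {set V} :=
  [set i | (preds i == set0) && (succs i != set0)].
Definition followers : {set V} :=
  [set i | (succs i == set0) && (preds i != set0)].
Definition isolated : {set V} :=
  [set i | (succs i == set0) && (preds i == set0)].

End Digraph.

Definition ones (V : finType) (x : {ffun V -> bool}) : {set V} :=
  [set i | x i].

Record gOLF (V : finType) := GOLF {
  golf_graph : digraph V;
  golf_ratio : rat;
  golf_quota : nat;
  golf_two_layered : two_layered golf_graph;
  golf_ratio_bounds : 1 / 2%:R <= golf_ratio <= 1;
  golf_quota_bounds : (0 < golf_quota <= #|V|)%N
}.

Section GOLF.
Variables (V : finType) (M : gOLF V).
Let G := golf_graph M.

Definition threshold (i : V) : int :=
  Num.ceil (golf_ratio M * (indegree G i)%:R).

Definition golf_choice (x : {ffun V -> bool}) (i : V) : bool :=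
  let p := #|[set j in preds G i | x j]|%:Z in
  let pbar := #|[set j in preds G i | ~~ x j]|%:Z in
  let t := threshold i in
  if (t <= p) && (pbar < t) then true
  else if (t <= pbar) && (p < t) then false
  else x i.

Definition golf_decision (x : {ffun V -> bool}) : bool :=
  (golf_quota M <= #|[set i | golf_choice x i]|)%N.

Definition odd_OLF : Prop :=
  golf_ratio M = 1 / 2%:R /\
  forall i, i \in followers G -> odd (indegree G i).

End GOLF.

Record influence_game (V : finType) := InfluenceGame {
  game_graph : digraph V;
  game_label : V -> rat;
  game_quota : nat;
  game_players : {set V};
  game_label_gt0 : forall i, 0 < game_label i;
  game_quota_le : (game_quota <= #|V|)%N
}.

Section InfluenceGame.
Variables (V : finType) (Gamma : influence_game V).

Definition spread_step (Y : {set V}) : {set V} :=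
  Y :|: [set i | game_label Gamma i
                 <= #|preds (game_graph Gamma) i :&: Y|%:R].

Definition spread_upto (t : nat) (X : {set V}) : {set V} :=
  iter t spread_step X.

Definition spread (X : {set V}) : {set V} := spread_upto #|V| X.

Definition oblivious_decision (x : {ffun V -> bool}) : bool :=
  (game_quota Gamma <= #|spread (ones x :&: game_players Gamma)|)%N.

End InfluenceGame.

Section GameOfGOLF.
Variables (V : finType) (M : gOLF V).
Let G := golf_graph M.

(* In a two layered graph every vertex outside [followers G] is a leader or
   isolated, see [followersC], so the last branch is the label of L and I. *)
Definition golf_label (i : V) : rat :=
  if i \in followers G then (threshold M i)%:~R else 1.

Lemma followersC : ~: followers G = leaders G :|: isolated G.
Proof.
have [V1 [V2 [_ dis12 E12]]] := golf_two_layered M.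
apply/setP=> i; rewrite !inE.
case: (set_0Vmem (preds G i)) => [->|[j ji]]; first by rewrite eqxx andbF; case: eqP.
have pn0 : preds G i != set0 by apply/set0Pn; exists j.
rewrite (negbTE pn0) !andbF andbT /=.
suff -> : succs G i = set0 by rewrite eqxx.
apply/setP=> k; rewrite !inE; apply/negP => ik.
move: ji; rewrite inE => ji.
by have := disjointFr dis12 (E12 _ _ ik).1; rewrite (E12 _ _ ji).2.
Qed.

Lemma golf_label_gt0 i : 0 < golf_label i.
Proof.
rewrite /golf_label; case: ifP => // iF.
have d_gt0 : (0 < indegree G i)%N.
  by move: iF; rewrite inE card_gt0 => /andP[].
have r_gt0 : 0 < golf_ratio M.
  by have /andP[+ _] := golf_ratio_bounds M; apply: lt_le_trans.
by rewrite ltr0z ceil_gt0 mulr_gt0 // ltr0n.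
Qed.

Lemma golf_quota_le : (golf_quota M <= #|V|)%N.
Proof. by have /andP[] := golf_quota_bounds M. Qed.

Definition golf_game : influence_game V :=
  {| game_graph := G;
     game_label := golf_label;
     game_quota := golf_quota M;
     game_players := leaders G :|: isolated G;
     game_label_gt0 := golf_label_gt0;
     game_quota_le := golf_quota_le |}.

End GameOfGOLF.

(* Main.v *)
(* An edge leaves a non-follower, so followers never influence anyone: one
   spreading step from the initial leaders and isolated vertices already
   reaches a fixed point. For an odd in-degree 2k + 1 and r = 1/2 the threshold
   is k + 1, hence exactly one of the two opinions meets it, and a follower ends
   up active iff at least k + 1 of its predecessors are. *)
Require Import Defs.
From mathcomp Require Import all_boot all_order all_algebra.
From mathcomp Require Import zify lra.

Set Implicit Arguments.
Unset Strict Implicit.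
Unset Printing Implicit Defensive.

Import Order.TTheory GRing.Theory Num.Theory.

Lemma ceil_half_odd (d : nat) :
  odd d -> Num.ceil (1 / 2%:R * d%:R : rat)%R = Posz d./2.+1.
Proof.
move=> odd_d; apply: ceil_def.
have -> : (d%:R = 1 + 2 * d./2%:R :> rat)%R.
  by rewrite -{1}[d]odd_double_half odd_d -mul2n natrD natrM.
(* With k for [d./2], the bounds that characterise the ceiling read k < k + 1/2 <= k + 1. *)
rewrite -!pmulrn subSS subn0 [in leRHS]mulrS.
by move: (d./2%:R)%R => k; lra.
Qed.

Section OddOLF.
Variables (V : finType) (M : gOLF V).
Let G := golf_graph M.

Lemma preds_nonfollower i : i \notin followers G -> preds G i = set0.
Proof.
by rewrite -in_setC followersC !inE => /orP[/andP[/eqP]|/andP[_ /eqP]].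
Qed.

Lemma edge_nonfollower i j : edge G i j -> i \notin followers G.
Proof.
move=> ij; rewrite inE negb_and; apply/orP; left.
by apply/set0Pn; exists j; rewrite inE.
Qed.

(** Without predecessors the threshold and both counts are 0, so both strict comparisons fail and
    the rule falls back on [x i]. *)
Lemma golf_choice_nonfollower x i :
  i \notin followers G -> golf_choice M x i = x i.
Proof.
move=> /preds_nonfollower pi0.
rewrite /golf_choice /threshold /indegree -/G pi0 cards0 mulr0 ceil0.
by rewrite ![(_ < 0)%R]ltNge !lez_nat !leq0n !andbF.
Qed.

Hypothesis oddM : odd_OLF M.

Lemma threshold_follower i :
  i \in followers G -> threshold M i = Posz (indegree G i)./2.+1.
Proof.
by case: oddM => half odd_in /odd_in; rewrite /threshold half; apply: ceil_half_odd.
Qed.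

Lemma golf_choice_follower x i : i \in followers G ->
  golf_choice M x i = ((indegree G i)./2 < #|[set j in preds G i | x j]|).
Proof.
move=> iF; have odd_i := oddM.2 i iF.
rewrite /golf_choice threshold_follower // -/G.
set p := #|[set j in _ | x j]|; set pbar := #|[set j in _ | ~~ x j]|.
have p_pbar : p + pbar = indegree G i.
  rewrite /indegree -(cardsID [set j | x j] (preds G i)).
  by congr (_ + _); apply: eq_card => j; rewrite !inE // andbC.
have := odd_double_half (indegree G i); rewrite odd_i => half_i.
rewrite !lez_nat !ltz_nat !ltnS; case: (ltnP _ p) => [kp | pk] /=.
  by have -> : pbar <= (indegree G i)./2 by lia.
by have -> : (indegree G i)./2 < pbar by lia.
Qed.

(** The hypotheses on [Y] are loose enough to cover both the initial set and the set of positive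
    choices, so this one lemma yields the first step and its stationarity. Predecessors of a
    follower are non-followers, where [Y] agrees with [x]. *)
Lemma spread_step_choice (x : {ffun V -> bool}) (Y : {set V}) :
    (forall i, i \notin followers G -> (i \in Y) = x i) ->
    (forall i, i \in followers G -> i \in Y -> golf_choice M x i) ->
  spread_step (golf_game M) Y = [set i | golf_choice M x i].
Proof.
move=> YN YF; apply/setP=> i; rewrite !inE /= /golf_label -/G.
case: (boolP (i \in followers G)) => iF; last first.
  (* The label 1 is never reached by an empty set of predecessors. *)
  by rewrite preds_nonfollower // set0I cards0 ler10 orbF YN //
             golf_choice_nonfollower.
have -> : preds G i :&: Y = [set j in preds G i | x j].
  apply/setP=> j; rewrite !inE; case: (boolP (edge G j i)) => //= ji.
  by rewrite YN // (edge_nonfollower ji).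
rewrite threshold_follower // pmulrn ler_int lez_nat -golf_choice_follower //.
by case: (boolP (i \in Y)) => //= /(YF i iF) ->.
Qed.

Lemma spread_choice x :
  spread (golf_game M) (ones x :&: game_players (golf_game M))
  = [set i | golf_choice M x i].
Proof.
rewrite /spread /spread_upto /= -/G -followersC.
(* A positive quota bounded by [#|V|] forces at least one spreading step; with none, no follower
   would be active. *)
have /andP[q_gt0 qV] := golf_quota_bounds M.
case: #|V| (leq_trans q_gt0 qV) => // n _.
elim: n => [|n IHn]; last rewrite iterS IHn.
  (* The initial set contains no follower, so the condition on followers is vacuous. *)
  apply: spread_step_choice => i iF; rewrite in_setI in_setC iF ?andbF //.
  by rewrite inE andbT.
apply: spread_step_choice => i iF; rewrite inE //.
exact: golf_choice_nonfollower.
Qed.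

End OddOLF.

Theorem lemma4 (V : finType) (M : gOLF V) (oddM : odd_OLF M)
    (x : {ffun V -> bool}) :
  golf_decision M x = oblivious_decision (golf_game M) x.
Proof.
by rewrite /oblivious_decision spread_choice.
Qed.
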